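(* The Russell collection $R=\{X \mid X \text{ is a set and } X\notin X\}$ is a proper class, not a set.
   Context: The ambient theory is a class theory of von Neumann–Bernays–Gödel type (foundation is not assumed) distinguishing sets from proper classes, in which in particular: (I) for every set $X$ the singleton $\{X\}$ is a set; (II) if $X$ and $Y$ are sets with no common elements then $X\cup Y$ is a set. Only sets can be elements of classes; every predicate on sets determines a class. *)

(* Defs.v *)
Set Implicit Arguments.

Record class_structure := ClassStructure {
  class :> Type;
  elt : class -> class -> Prop;
  is_set : class -> Prop
}.

Arguments is_set {c} _.

Notation "X ∈ Y" := (elt _ X Y) (at level 70, no associativity).
Notation "X ∉ Y" := (~ elt _ X Y) (at level 70, no associativity).

Definition proper_class {M : class_structure} (X : M) : Prop := ~ is_set X.

(* The language in which predicates on sets are written: first-order formulas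
   with de Bruijn variables, class parameters being allowed, and with
   quantifiers ranging over sets only (predicative, as in von
   Neumann-Bernays-Gödel class theory). *)
Inductive formula : Type :=
| f_elt (i j : nat)
| f_eq (i j : nat)
| f_false
| f_imp (p q : formula)
| f_and (p q : formula)
| f_or (p q : formula)
| f_all (p : formula)
| f_ex (p : formula).

Definition extend (T : Type) (x : T) (e : nat -> T) (i : nat) : T :=
  match i with
  | O => x
  | S j => e j
  end.

Fixpoint holds {M : class_structure} (e : nat -> M) (p : formula) : Prop :=
  match p with
  | f_elt i j => e i ∈ e j
  | f_eq i j => e i = e j
  | f_false => False
  | f_imp p q => holds e p -> holds e q
  | f_and p q => holds e p /\ holds e q
  | f_or p q => holds e p \/ holds e q
  | f_all p => forall X : M, is_set X -> holds (extend X e) p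
  | f_ex p => exists X : M, is_set X /\ holds (extend X e) p
  end.

(* [comprehension] is a schema: the class {X | X is a set and p(X)} exists for
   every formula p in the variable 0, the other variables being parameters.
   [nonempty_universe] is the usual convention of first-order semantics.
   Foundation is not among the axioms. *)
Record class_theory := ClassTheory {
  structure :> class_structure;
  nonempty_universe : inhabited structure;
  extensionality : forall X Y : structure,
    (forall Z : structure, Z ∈ X <-> Z ∈ Y) -> X = Y;
  elements_are_sets : forall X Y : structure, X ∈ Y -> is_set X;
  comprehension : forall (p : formula) (e : nat -> structure),
    exists C : structure,
      forall X : structure, X ∈ C <-> is_set X /\ holds (extend X e) p;
  singleton_set : forall X : structure, is_set X ->
    exists S : structure,
      is_set S /\ forall Z : structure, Z ∈ S <-> Z = X;
  disjoint_union_set : forall X Y : structure, is_set X -> is_set Y ->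
    ~ (exists Z : structure, Z ∈ X /\ Z ∈ Y) ->
    exists U : structure,
      is_set U /\ forall Z : structure, Z ∈ U <-> Z ∈ X \/ Z ∈ Y
}.

(* R is the class {X | X is a set and X ∉ X}; extensionality makes it unique. *)
Definition is_russell_class {M : class_structure} (R : M) : Prop :=
  forall X : M, X ∈ R <-> is_set X /\ X ∉ X.

(* Main.v *)
Require Import Defs.

(** Russell's paradox, read as a refutation of sethood: comprehension ranges over sets only, so [R]
    exists without contradiction, and the paradox arises only once [R] is assumed to be a set. *)

Theorem proposition2 (T : class_theory) :
  exists R : T, unique is_russell_class R /\ proper_class R.
Proof.
  destruct (nonempty_universe T) as [X0].
  (* Variable 0 is the comprehended one, so [f_elt 0 0] reads X ∈ X; the
     formula has no parameters and X0 is a dummy valuation. *)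
  destruct (comprehension T (f_imp (f_elt 0 0) f_false) (fun _ => X0)) as [R HR].
  exists R; split; [split|].
  - exact HR.
  (* Once evaluated by [simpl], the formula in [HR] is the same condition on [Z] as in [HR']. *)
  - intros R' HR'; apply extensionality; intro Z.
    specialize (HR Z); specialize (HR' Z); simpl in HR; tauto.
  (* Diagonal instance: given [setR], it reads R ∈ R <-> R ∉ R, which is contradictory even
     intuitionistically. *)
  - intro setR; specialize (HR R); simpl in HR; tauto.
Qed.
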